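(* A probability measure $\mu$ on $[n]^n$ is an $S_n$-determinantal measure if and only if there exist a bipartite Pfaffian graph $\mathcal{G}$ with $n$ white vertices and $n$ black vertices, positive edge weights on $\mathcal{G}$, and a corresponding Kasteleyn matrix $K$, such that $\mu$ is the $n$-determinantal measure with matrices $$A_i=u_iv_i^t,\qquad i=1,\dots,n,$$ where $v_i^t$ is the $i$th row of $K$ and $u_i$ is the $i$th column of $K^{-1}$.
   Context: $[n]=\{1,\dots,n\}$. An $n$-determinantal measure on $[n]^n$ with matrices $A_1,\dots,A_n$ is a probability measure on $[n]^n$, where the $A_i$ are real $n\times n$ matrices with $A_1+\dots+A_n=I$, and for all $(i_1,\dots,i_n)\in[n]^n$, $\Pr((i_1,\dots,i_n))=\det(A_{i_1}^1,A_{i_2}^2,\dots,A_{i_n}^n)$, the determinant of the matrix whose $j$th column is the $j$th column of $A_{i_j}$. An $S_n$-determinantal measure (determinantal permutation measure) is an $n$-determinantal measure on $[n]^n$ for which the matrices $A_i$ can be taken to have rank $1$ each; it is then supported on sequences that are permutations of $[n]$. A bipartite graph with $n$ white and $n$ black vertices (each numbered $1,\dots,n$) is a bipartite Pfaffian graph if it has a perfect matching and admits a Kasteleyn signing, i.e. an assignment of signs $\pm1$ to its edges such that, for positive edge weights $\nu_e$, the matrix $K$ with $K(w,b)=\pm\nu_{wb}$ (sign given by the signing) if $w,b$ are adjacent and $K(w,b)=0$ otherwise has all nonzero terms $(-1)^\sigma K(1,\sigma(1))\cdots K(n,\sigma(n))$, $\sigma\in S_n$, in the expansion of its determinant of the same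 sign. (This property does not depend on the choice of positive weights.) Such a $K$ is called a Kasteleyn matrix of the weighted graph; it is invertible. *)

(* Defs.v *)
From mathcomp Require Import all_boot all_order all_fingroup all_algebra.
From mathcomp Require Import reals.

Set Implicit Arguments.
Unset Strict Implicit.
Unset Printing Implicit Defensive.

Import Order.TTheory GRing.Theory Num.Theory.
Local Open Scope ring_scope.

(* The set [n] = {1, ..., n} is encoded as 'I_n, hence [n]^n as
   {ffun 'I_n -> 'I_n}. A probability measure on this finite set is given by
   the masses of its points. *)
Definition prob_measure (R : realType) (n : nat)
    (mu : {ffun 'I_n -> 'I_n} -> R) : Prop :=
  (forall x, 0 <= mu x) /\ \sum_x mu x = 1.

Definition mixed_columns (R : realType) (n : nat) (A : 'I_n -> 'M[R]_n)
    (x : {ffun 'I_n -> 'I_n}) : 'M[R]_n :=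
  \matrix_(k, j) A (x j) k j.

Definition determinantal_measure (R : realType) (n : nat)
    (mu : {ffun 'I_n -> 'I_n} -> R) (A : 'I_n -> 'M[R]_n) : Prop :=
  [/\ prob_measure mu,
      \sum_i A i = 1%:M
    & forall x, mu x = \det (mixed_columns A x)].

Definition Sn_determinantal_measure (R : realType) (n : nat)
    (mu : {ffun 'I_n -> 'I_n} -> R) : Prop :=
  exists A : 'I_n -> 'M[R]_n,
    determinantal_measure mu A /\ forall i, \rank (A i) = 1%N.

(* White and black vertices are two copies of 'I_n; the pair (w, b) is the
   edge joining the white vertex w to the black vertex b. *)
Definition bigraph (n : nat) : Type := {set 'I_n * 'I_n}.

Definition perfect_matching (n : nat) (G : bigraph n)
    (M : {set 'I_n * 'I_n}) : Prop :=
  [/\ M \subset G,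
      forall w, #|[set e in M | e.1 == w]| = 1%N
    & forall b, #|[set e in M | e.2 == b]| = 1%N].

(* Weights and signings are total functions on pairs of vertices, but only
   their values on the edges matter. *)
Definition positive_weights (R : realType) (n : nat) (G : bigraph n)
    (nu : 'I_n * 'I_n -> R) : Prop :=
  forall e, e \in G -> 0 < nu e.

(* The boolean s e encodes the sign (-1) ^+ s e, so true stands for -1. *)
Definition signed_matrix (R : realType) (n : nat) (G : bigraph n)
    (s : 'I_n * 'I_n -> bool) (nu : 'I_n * 'I_n -> R) : 'M[R]_n :=
  \matrix_(w, b) if (w, b) \in G then (-1) ^+ s (w, b) * nu (w, b) else 0.

Definition det_term (R : realType) (n : nat) (K : 'M[R]_n) (sigma : 'S_n) : R :=
  (-1) ^+ sigma * \prod_i K i (sigma i).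

Definition det_terms_same_sign (R : realType) (n : nat) (K : 'M[R]_n) : Prop :=
  forall sigma tau : 'S_n,
    det_term K sigma != 0 -> det_term K tau != 0 ->
    Num.sg (det_term K sigma) = Num.sg (det_term K tau).

(* Quantifying over all positive weights is no restriction: whether the terms
   have the same sign does not depend on the choice of the weights. *)
Definition kasteleyn_signing (R : realType) (n : nat) (G : bigraph n)
    (s : 'I_n * 'I_n -> bool) : Prop :=
  forall nu : 'I_n * 'I_n -> R,
    positive_weights G nu -> det_terms_same_sign (signed_matrix G s nu).

Definition bipartite_pfaffian (R : realType) (n : nat) (G : bigraph n) : Prop :=
  (exists M, perfect_matching G M) /\ (exists s, kasteleyn_signing R G s).

(* When G has a perfect matching, such a K is automatically invertible: its
   determinant is a nonempty sum of nonzero terms of the same sign. *)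
Definition kasteleyn_matrix (R : realType) (n : nat) (G : bigraph n)
    (nu : 'I_n * 'I_n -> R) (K : 'M[R]_n) : Prop :=
  exists s, kasteleyn_signing R G s /\ K = signed_matrix G s nu.

(* Main.v *)
(** Writing the rank-one matrices as [A_i = u_i v_i], the condition
    [\sum_i A_i = 1] says that the matrix [U] with columns [u_i] is the inverse
    of the matrix [K] with rows [v_i].  By multilinearity the mass of a
    permutation [sigma] is [det_term K sigma^-1 * \det U], so nonnegativity of
    the measure says exactly that all the nonzero terms of [\det K] have the
    sign of [\det K]: [K] is a Kasteleyn matrix of the graph of its nonzero
    entries. *)
Require Import Defs.
From mathcomp Require Import all_boot all_order all_fingroup all_algebra.
From mathcomp Require Import reals.
Set Implicit Arguments.
Unset Strict Implicit.
Unset Printing Implicit Defensive.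
Import Order.TTheory GRing.Theory Num.Theory.
Local Open Scope ring_scope.

(** The factorization [col_base A *m row_base A] has inner dimension [\rank A]. *)
Lemma rank1_factor (F : fieldType) (m n : nat) (A : 'M[F]_(m, n)) :
  \rank A = 1%N -> exists (u : 'cV_m) (v : 'rV_n), A = u *m v.
Proof.
move=> rA; move: (col_base A) (row_base A) (mulmx_base A); rewrite rA.
by move=> u v <-; exists u, v.
Qed.

(** Outer-product expansion: it turns the condition [\sum_i A i = 1%:M] into a matrix product equal
    to the identity. *)
Lemma sum_col_mul_row (R : pzRingType) (m n p : nat)
    (B : 'M[R]_(m, n)) (C : 'M[R]_(n, p)) :
  \sum_i col i B *m row i C = B *m C.
Proof.
apply/matrixP=> a b; rewrite summxE mxE; apply: eq_bigr => i _.
by rewrite mxE big_ord1 !mxE.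
Qed.

(** Column [j] of the mixed matrix is column [s j] of [U] scaled by [K (s j) j]. The inverse of [s]
    appears because [det_term] indexes its factors by rows rather than by columns. *)
Lemma mixed_columns_rank1 (R : realType) (n : nat) (U K : 'M[R]_n)
    (s : 'S_n) (A : 'I_n -> 'M[R]_n) :
  (forall i, A i = col i U *m row i K) ->
  \det (mixed_columns A [ffun i => s i]) = det_term K (s^-1)%g * \det U.
Proof.
move=> AE.
have -> : mixed_columns A [ffun i => s i]
    = col_perm s U *m diag_mx (\row_j K (s j) j).
  apply/matrixP=> a b; rewrite mul_mx_diag !mxE ffunE AE mxE big_ord1.
  by rewrite !mxE.
rewrite det_mulmx det_diag col_permE det_mulmx det_perm /det_term.
rewrite -mulrA mulrC; congr (_ * \det U).
rewrite [in RHS](reindex_inj (@perm_inj _ s)); congr (_ * _).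
by apply: eq_bigr => j _; rewrite mxE permK.
Qed.

Section SupportGraph.
Variables (R : realType) (n : nat) (K : 'M[R]_n).

Definition support_graph : bigraph n := [set e | K e.1 e.2 != 0].
Definition entry_sign (e : 'I_n * 'I_n) : bool := K e.1 e.2 < 0.
Definition entry_weight (e : 'I_n * 'I_n) : R := `|K e.1 e.2|.

Lemma entry_weight_positive : positive_weights support_graph entry_weight.
Proof. by move=> e; rewrite inE normr_gt0. Qed.

Lemma signed_matrix_entries :
  signed_matrix support_graph entry_sign entry_weight = K.
Proof.
apply/matrixP=> w b; rewrite mxE inE /=; case: ifPn => [nz|/negPn/eqP-> //].
by rewrite /entry_sign /entry_weight -realEsign ?num_real.
Qed.

Lemma sgr_signed_matrix (nu : 'I_n * 'I_n -> R) (w b : 'I_n) :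
  positive_weights support_graph nu ->
  Num.sg (signed_matrix support_graph entry_sign nu w b) = Num.sg (K w b).
Proof.
move=> nu_gt0; rewrite mxE; case: ifPn => [wbG|].
  rewrite sgrM (gtr0_sg (nu_gt0 _ wbG)) mulr1 sgrX sgrN1.
  by rewrite neqr0_sign //; move: wbG; rewrite inE.
by rewrite inE /= => /negPn/eqP ->.
Qed.

Lemma sgr_det_term (nu : 'I_n * 'I_n -> R) (s : 'S_n) :
  positive_weights support_graph nu ->
  Num.sg (det_term (signed_matrix support_graph entry_sign nu) s)
    = Num.sg (det_term K s).
Proof.
move=> nu_gt0; rewrite !sgrM; congr (_ * _).
rewrite !(big_morph _ (@sgrM R) (@sgr1 R)); apply: eq_bigr => i _.
exact: sgr_signed_matrix.
Qed.

(** Changing the positive weights preserves the sign of every entry, hence of every term, zero terms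
    included; so it is enough that the terms of [K] itself agree. *)
Lemma support_kasteleyn_signing :
  det_terms_same_sign K -> kasteleyn_signing R support_graph entry_sign.
Proof.
move=> same nu nu_gt0 s t.
rewrite -sgr_eq0 -[det_term _ t == 0]sgr_eq0 !sgr_det_term // !sgr_eq0.
exact: same.
Qed.

(** A nonzero determinant has a nonzero term in its Leibniz expansion, and the graph of the
    permutation of that term is a matching. *)
Lemma support_perfect_matching :
  \det K != 0 -> exists M, perfect_matching support_graph M.
Proof.
move=> detK.
have [s nz] : exists s : 'S_n, \prod_i K i (s i) != 0.
  apply/existsP; apply: contraNT detK; rewrite negb_exists => /forallP z.
  by rewrite /determinant big1 // => s _; move/negPn/eqP: (z s) => ->; rewrite mulr0.
exists [set (i, s i) | i in 'I_n]; split=> [|w|b].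
- apply/subsetP=> _ /imsetP[i _ ->]; rewrite inE /=.
  by move/prodf_neq0: nz; apply.
- rewrite -(cards1 (w, s w)); congr #|pred_of_set _|; apply/setP=> -[i j].
  rewrite !inE /=; apply/andP/eqP => [[/imsetP[k _ [-> ->]] /eqP -> //]|[-> ->]].
  by rewrite imset_f.
- rewrite -(cards1 ((s^-1)%g b, b)); congr #|pred_of_set _|; apply/setP=> -[i j].
  rewrite !inE /=; apply/andP/eqP => [[/imsetP[k _ [-> ->]] /eqP <-]|[-> ->]].
    by rewrite permK.
  by split=> //; apply/imsetP; exists ((s^-1)%g b); rewrite ?permKV.
Qed.

End SupportGraph.

(** Each nonzero term has a positive product with [c], hence the sign of [c]. *)
Lemma nonneg_multiple_same_sign (R : realType) (n : nat) (K : 'M[R]_n) (c : R) :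
  c != 0 -> (forall s : 'S_n, 0 <= det_term K s * c) -> det_terms_same_sign K.
Proof.
move=> c0 ge0.
have sgE s : det_term K s != 0 -> Num.sg (det_term K s) = Num.sg c.
  move=> nz; have : 0 < det_term K s * c by rewrite lt_def mulf_neq0 ?ge0.
  case: (ltgtP c 0) c0 => // c_sgn _.
    by rewrite nmulr_lgt0 // => /ltr0_sg ->; rewrite ltr0_sg.
  by rewrite pmulr_lgt0 // => /gtr0_sg ->; rewrite gtr0_sg.
by move=> s t sn tn; rewrite !sgE.
Qed.

Theorem theorem6 (R : realType) (n : nat) (mu : {ffun 'I_n -> 'I_n} -> R) :
  prob_measure mu ->
  (Sn_determinantal_measure mu <->
   exists (G : bigraph n) (nu : 'I_n * 'I_n -> R) (K : 'M[R]_n),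
     [/\ bipartite_pfaffian R G,
         positive_weights G nu,
         kasteleyn_matrix G nu K
       & determinantal_measure mu (fun i => col i (invmx K) *m row i K)]).
Proof.
move=> mu_prob; split; last first.
  move=> [G [nu [K [_ _ _ dm]]]]; exists (fun i => col i (invmx K) *m row i K).
  split=> // i; have [_ /= sum1 _] := dm.
  (* The matrices sum to the identity, so [invmx K] is a genuine inverse of [K] and not the default
     value of [invmx]. *)
  have VK : invmx K *m K = 1%:M by rewrite -sum_col_mul_row.
  have KV : row i K *m col i (invmx K) = 1%:M.
    apply/matrixP=> a b; rewrite colE -row_mul mulmxA (mulmx1C VK) mul1mx.
    by rewrite !ord1 !mxE !eqxx.
  apply/eqP; rewrite eqn_leq (leq_trans (mxrankM_maxr _ _) (rank_leq_row _)) /=.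
  (* Rank at least 1: with [v] the row and [u] the column, [v *m (u *m v) *m u] is the square of
     [v *m u = 1], so its rank 1 bounds that of [u *m v] from below. *)
  rewrite -[X in (X <= _)%N](mxrank1 R 1) -[1%:M](mulmx1 1%:M) -{1}KV -KV.
  rewrite -mulmxA (mulmxA (col _ _)).
  exact: leq_trans (mxrankM_maxr _ _) (mxrankM_maxl _ _).
move=> [A [[_ sumA muE] rkA]].
have /fin_all_exists[u /fin_all_exists[v AE]] i := rank1_factor (rkA i).
pose U : 'M[R]_n := \matrix_(i, j) u j i 0.
pose K : 'M[R]_n := \matrix_(i, j) v i 0 j.
have AUK i : A i = col i U *m row i K.
  rewrite AE; congr (_ *m _); apply/matrixP=> a b.
    by rewrite !mxE ord1.
  by rewrite !mxE ord1.
have UK : U *m K = 1%:M.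
  by rewrite -sum_col_mul_row -sumA; apply: eq_bigr => i _; rewrite AUK.
have [unitU unitK] := mulmx1_unit UK.
have invK : invmx K = U by rewrite -[LHS]mul1mx -UK mulmxK.
have same : det_terms_same_sign K.
  apply: (@nonneg_multiple_same_sign _ _ _ (\det U)) => [|s].
    by rewrite -unitfE -unitmxE.
  (* [det_term K s * \det U] is the mass of the sequence given by [s^-1]. *)
  rewrite -[s]invgK -(mixed_columns_rank1 _ AUK) -muE.
  exact: (proj1 mu_prob).
exists (support_graph K), (entry_weight K), K; split.
- split; first by apply: support_perfect_matching; rewrite -unitfE -unitmxE.
  by exists (entry_sign K); apply: support_kasteleyn_signing.
- exact: entry_weight_positive.
- exists (entry_sign K); split; first exact: support_kasteleyn_signing.
  by rewrite signed_matrix_entries.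
- rewrite invK; split=> //; first by rewrite sum_col_mul_row.
  move=> x; rewrite muE; congr (\det _).
  by apply/matrixP=> a b; rewrite !mxE AUK mxE.
Qed.
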